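(* For the spaces of constant curvature, i.e. for a Riemannian manifold $(M,g)$ whose curvature tensor is expressed in terms of the curvature $\kappa$ and the metric tensor $g_{ij}$ by $$R^i{}_{jkl}=\kappa\,(g^i_k\, g_{jl}-g^i_l\, g_{jk}),$$ $\zeta=\kappa$ is the M-eigenvalue (of the Riemann curvature tensor).
   Context: Let $(M,g)$ be an $n$-dimensional Riemannian manifold with Levi-Civita connection $\nabla$, write $\langle\cdot,\cdot\rangle=g$, and let $g^i_k=\delta^i_k$ be the Kronecker delta (the mixed components of the metric). The curvature is $R(X,Y)=[\nabla_X,\nabla_Y]-\nabla_{[X,Y]}$, with components in local coordinates given by $R(\partial_k,\partial_l)\partial_j=R^i{}_{jkl}\,\partial_i$ and $R_{ijkl}=g_{ih}R^h{}_{jkl}$. The case $\kappa=0$ is Euclidean space, $\kappa>0$ is the sphere of radius $1/\sqrt{\kappa}$, and $\kappa<0$ is a Lobachevskii space. M-eigenproblem: at a point $p\in M$, one seeks a real number $\zeta$ (an M-eigenvalue of the Riemann curvature tensor) and real vectors $x,y\in T_pM$ (M-eigenvectors) such that $$R(y,x)x=\zeta y,\qquad R(x,y)y=\zeta x,\qquad \langle x,x\rangle=\langle y,y\rangle=1,$$ or, in components, $R_{abcd}\,x^b y^c x^d=\zeta y_a$ and $R_{abcd}\,y^b x^c y^d=\zeta x_a$ with $g_{ij}x^ix^j=g_{ij}y^iy^j=1$, where $x_a=g_{ak}x^k$ and $y_a=g_{ak}y^k$.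
   Formalization: Dimension n ≥ 2 is assumed, since for n = 1 the curvature condition holds for every κ while the only M-eigenvalue is 0; ''the'' M-eigenvalue is read as: κ is one, and it is the only one having M-eigenvectors with y ≠ ±x (y = ±x always gives ζ = 0). *)

(* Defs.v *)
From HB Require Import structures.
From mathcomp Require Import all_boot all_order all_algebra.
From mathcomp Require Import all_classical all_reals all_analysis.
From mathcomp Require Import ring lra.

Set Implicit Arguments.
Unset Strict Implicit.
Unset Printing Implicit Defensive.

Import Order.TTheory GRing.Theory Num.Theory.
Import numFieldNormedType.Exports.

Local Open Scope classical_set_scope.
Local Open Scope ring_scope.

(* A function is of class C^(k+1) on the open set U when it is Frechet
   differentiable there and all its directional derivatives are C^k on U.
   Values taken outside U are irrelevant. *)
Fixpoint class_C (R : realType) (V W : normedModType R) (k : nat)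
    (U : set V) (f : V -> W) : Prop :=
  if k is k'.+1 then
    (forall u, U u -> differentiable f u) /\
    (forall v, class_C k' U (fun u => 'D_v f u))
  else forall u, U u -> {for u, continuous f}.

Definition smooth_on (R : realType) (V W : normedModType R)
    (U : set V) (f : V -> W) : Prop :=
  forall k, class_C k U f.

(* An n-dimensional smooth manifold without boundary, given by a smooth atlas.
   [chart_map c] is meaningful on [chart_dom c] only, and [chart_inv c] on the
   image [chart_map c @` chart_dom c] only, where it is the inverse of
   [chart_map c]. *)
Record smooth_manifold (R : realType) (n : nat) := SmoothManifold {
  carrier :> topologicalType;
  chart : Type;
  chart_dom : chart -> set carrier;
  chart_map : chart -> carrier -> 'rV[R]_n;
  chart_inv : chart -> 'rV[R]_n -> carrier;
  manifold_hausdorff : hausdorff_space carrier;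
  manifold_second_countable : @second_countable carrier;
  chart_dom_open : forall c, open (chart_dom c);
  chart_dom_cover : forall p, exists c, chart_dom c p;
  chart_image_open : forall c, open (chart_map c @` chart_dom c);
  chart_mapK : forall c p, chart_dom c p -> chart_inv c (chart_map c p) = p;
  chart_map_continuous : forall c p, chart_dom c p ->
    {for p, continuous (chart_map c)};
  chart_inv_continuous : forall c u, (chart_map c @` chart_dom c) u ->
    {for u, continuous (chart_inv c)};
  transition_smooth : forall c d,
    smooth_on (chart_map c @` (chart_dom c `&` chart_dom d))
      (chart_map d \o chart_inv c)
}.

(* A Riemannian metric, given by its component matrices g_ij as functions of
   the coordinates of each chart.  The library's Jacobian acts on row vectors,
   i.e. ('J f u) i a is the i-th partial derivative of the a-th component of f,
   so [metric_change] is the transformation law of a (0,2)-tensor. *)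
Record riemannian_metric (R : realType) (n : nat) (M : smooth_manifold R n) :=
  RiemannianMetric {
  metric : chart M -> 'rV[R]_n -> 'M[R]_n;
  metric_smooth : forall c, smooth_on (chart_map c @` chart_dom c) (metric c);
  metric_sym : forall c u, (chart_map c @` chart_dom c) u ->
    (metric c u)^T = metric c u;
  metric_pos : forall c u, (chart_map c @` chart_dom c) u ->
    forall v : 'rV[R]_n, v != 0 -> 0 < (v *m metric c u *m v^T) 0 0;
  metric_change : forall c d (p : M), chart_dom c p -> chart_dom d p ->
    let J := 'J (chart_map d \o chart_inv c) (chart_map c p) in
    metric c (chart_map c p) = J *m metric d (chart_map d p) *m J^T
}.

(* Below, h : 'rV[R]_n -> 'M[R]_n stands for the components of a metric in
   some coordinates, and X Y Z : 'rV[R]_n -> 'rV[R]_n for the components of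
   vector fields. *)

Definition partial (R : realType) (n : nat) (k : 'I_n) (f : 'rV[R]_n -> R)
    (u : 'rV[R]_n) : R :=
  'D_(delta_mx 0 k) f u.

(* [christoffel h u i j k] is the symbol with upper index i and lower indices
   j and k. *)
Definition christoffel (R : realType) (n : nat) (h : 'rV[R]_n -> 'M[R]_n)
    (u : 'rV[R]_n) (i j k : 'I_n) : R :=
  2^-1 * \sum_(l < n) invmx (h u) i l *
    (partial j (fun w => h w l k) u + partial k (fun w => h w j l) u
     - partial l (fun w => h w j k) u).

(* Levi-Civita covariant derivative of Z along X. *)
Definition nabla (R : realType) (n : nat) (h : 'rV[R]_n -> 'M[R]_n)
    (X Z : 'rV[R]_n -> 'rV[R]_n) (u : 'rV[R]_n) : 'rV[R]_n :=
  'D_(X u) Z u +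
  \row_(i < n) \sum_(j < n) \sum_(k < n)
    christoffel h u i j k * X u 0 j * Z u 0 k.

Definition lie_bracket (R : realType) (n : nat)
    (X Y : 'rV[R]_n -> 'rV[R]_n) (u : 'rV[R]_n) : 'rV[R]_n :=
  'D_(X u) Y u - 'D_(Y u) X u.

(* The next lemmas confirm that [nabla] is torsion-free and compatible with the
   metric. *)

Lemma partial_metricC (R : realType) (n : nat) (h : 'rV[R]_n -> 'M[R]_n)
    (u : 'rV[R]_n) (k i j : 'I_n) :
  (\forall w \near u, (h w)^T = h w) ->
  partial k (fun w => h w i j) u = partial k (fun w => h w j i) u.
Proof.
move=> sym; by apply: near_eq_derive => //; near=> w; rewrite -[in LHS](near sym w) ?mxE.
Unshelve. all: end_near. Qed.

Lemma nabla_torsion_free (R : realType) (n : nat) (h : 'rV[R]_n -> 'M[R]_n)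
    (X Y : 'rV[R]_n -> 'rV[R]_n) (u : 'rV[R]_n) :
  (\forall w \near u, (h w)^T = h w) ->
  nabla h X Y u - nabla h Y X u = lie_bracket X Y u.
Proof.
move=> sym; rewrite /nabla /lie_bracket opprD addrACA.
rewrite -[RHS]addr0; congr (_ + _); apply/eqP; rewrite subr_eq0; apply/eqP.
apply/rowP => i; rewrite !mxE exchange_big /=.
apply: eq_bigr => j _; apply: eq_bigr => k _.
rewrite mulrAC; congr (_ * _ * _); rewrite /christoffel; congr (_ * _).
apply: eq_bigr => l _; congr (_ * _).
rewrite (@partial_metricC _ _ _ _ l k j) // (@partial_metricC _ _ _ _ k l j) //.
by rewrite (@partial_metricC _ _ _ _ j k l) // (addrC (partial k _ _)).
Qed.

(* nabla g = 0 in components. *)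
Lemma christoffel_metric (R : realType) (n : nat) (h : 'rV[R]_n -> 'M[R]_n)
    (u : 'rV[R]_n) (k i j : 'I_n) :
  (\forall w \near u, (h w)^T = h w) -> h u \in unitmx ->
  partial k (fun w => h w i j) u =
  \sum_(l < n) christoffel h u l k i * h u l j +
  \sum_(l < n) christoffel h u l k j * h u i l.
Proof.
move=> sym hU.
have hS a b : h u a b = h u b a.
  by rewrite -[in LHS](nbhs_singleton sym) mxE.
have lower a b : \sum_(l < n) christoffel h u l k a * h u b l =
   2^-1 * (partial k (fun w => h w b a) u + partial a (fun w => h w k b) u
     - partial b (fun w => h w k a) u).
  pose T m := partial k (fun w => h w m a) u + partial a (fun w => h w k m) u
     - partial m (fun w => h w k a) u.
  rewrite -[RHS]/(2^-1 * T b).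
  rewrite /christoffel; under eq_bigr do rewrite -mulrA mulr_suml.
  rewrite -mulr_sumr exchange_big /=; congr (_ * _).
  under eq_bigr => m _.
    under eq_bigr => l _ do rewrite mulrAC -/(T m) (mulrC (invmx _ _ _)).
    rewrite -mulr_suml.
    have -> : \sum_(l < n) h u b l * invmx (h u) l m = (b == m)%:R.
      by have /matrixP/(_ b m) := mulmxV hU; rewrite !mxE.
    over.
  rewrite (bigD1 b) //= eqxx mul1r big1 ?addr0 // => m /negPf mb.
  by rewrite eq_sym mb mul0r.
under eq_bigr do rewrite hS.
rewrite !lower -mulrDr (@partial_metricC _ _ _ _ k j i) //.
rewrite (@partial_metricC _ _ _ _ i k j) // (@partial_metricC _ _ _ _ j k i) //.
rewrite (@partial_metricC _ _ _ _ i j k) // (@partial_metricC _ _ _ _ j i k) //.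
by lra.
Qed.

(* R(X,Y)Z = [nabla_X, nabla_Y] Z - nabla_[X,Y] Z *)
Definition curvature (R : realType) (n : nat) (h : 'rV[R]_n -> 'M[R]_n)
    (X Y Z : 'rV[R]_n -> 'rV[R]_n) (u : 'rV[R]_n) : 'rV[R]_n :=
  nabla h X (nabla h Y Z) u - nabla h Y (nabla h X Z) u
  - nabla h (lie_bracket X Y) Z u.

Definition coord_field (R : realType) (n : nat) (k : 'I_n) (u : 'rV[R]_n) :
    'rV[R]_n :=
  delta_mx 0 k.

(* R^i_{jkl}, defined by R(d_k,d_l)d_j = R^i_{jkl} d_i. *)
Definition curvature_components (R : realType) (n : nat)
    (h : 'rV[R]_n -> 'M[R]_n) (u : 'rV[R]_n) (i j k l : 'I_n) : R :=
  curvature h (coord_field k) (coord_field l) (coord_field j) u 0 i.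

(* A tangent vector at p is represented by the row vector of its components
   in the coordinate basis of a chart c around p. *)

Definition inner (R : realType) (n : nat) (M : smooth_manifold R n)
    (g : riemannian_metric M) (c : chart M) (p : M) (x y : 'rV[R]_n) : R :=
  (x *m metric g c (chart_map c p) *m y^T) 0 0.

Definition riemann (R : realType) (n : nat) (M : smooth_manifold R n)
    (g : riemannian_metric M) (c : chart M) (p : M) (x y z : 'rV[R]_n) :
    'rV[R]_n :=
  \row_(i < n) \sum_(j < n) \sum_(k < n) \sum_(l < n)
    curvature_components (metric g c) (chart_map c p) i j k l
    * z 0 j * x 0 k * y 0 l.

Definition constant_curvature (R : realType) (n : nat)
    (M : smooth_manifold R n) (g : riemannian_metric M) (kappa : R) : Prop :=
  forall (c : chart M) (p : M), chart_dom c p -> forall i j k l : 'I_n,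
    let h := metric g c (chart_map c p) in
    curvature_components (metric g c) (chart_map c p) i j k l =
    kappa * ((i == k)%:R * h j l - (i == l)%:R * h j k).

(* zeta is an M-eigenvalue at p with M-eigenvectors x and y.  The unit pairs
   y = x and y = - x are not excluded; the antisymmetry R(x,x) = 0 makes them
   M-eigenvectors for zeta = 0. *)
Definition M_eigen (R : realType) (n : nat) (M : smooth_manifold R n)
    (g : riemannian_metric M) (c : chart M) (p : M)
    (zeta : R) (x y : 'rV[R]_n) : Prop :=
  [/\ riemann g c p y x x = zeta *: y,
      riemann g c p x y y = zeta *: x,
      inner g c p x x = 1
    & inner g c p y y = 1].

Definition is_M_eigenvalue (R : realType) (n : nat) (M : smooth_manifold R n)
    (g : riemannian_metric M) (c : chart M) (p : M) (zeta : R) : Prop :=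
  exists x y : 'rV[R]_n, M_eigen g c p zeta x y.

(* Main.v *)
(* Contracting the curvature hypothesis gives
   R(x,y)z = kappa (<z,y> x - <z,x> y), so orthonormal x, y are M-eigenvectors
   for kappa.  Conversely, R(y,x)x = zeta y reads
   (kappa - zeta) y = kappa <x,y> x, so zeta <> kappa forces the unit vectors
   x and y to be collinear, that is y = x or y = -x. *)
Require Import Defs.
From mathcomp Require Import all_boot all_order all_algebra.
From mathcomp Require Import all_classical all_reals all_analysis.
From mathcomp Require Import ring.
Import Order.TTheory GRing.Theory Num.Theory.

Local Open Scope ring_scope.

Lemma innerE (R : realType) (n : nat) (M : smooth_manifold R n)
    (g : riemannian_metric M) (c : chart M) (p : M) (x y : 'rV[R]_n) :
  inner g c p x y =
  \sum_j \sum_k x 0 j * metric g c (chart_map c p) j k * y 0 k.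
Proof.
rewrite /inner mxE exchange_big; apply: eq_bigr => k _.
by rewrite mxE mulr_suml; apply: eq_bigr => j _; rewrite mxE.
Qed.

Lemma innerBl (R : realType) (n : nat) (M : smooth_manifold R n)
    (g : riemannian_metric M) (c : chart M) (p : M) (x y z : 'rV[R]_n) :
  inner g c p (x - y) z = inner g c p x z - inner g c p y z.
Proof. by rewrite /inner !mulmxBl !mxE. Qed.

Lemma innerZl (R : realType) (n : nat) (M : smooth_manifold R n)
    (g : riemannian_metric M) (c : chart M) (p : M) (a : R) (x y : 'rV[R]_n) :
  inner g c p (a *: x) y = a * inner g c p x y.
Proof. by rewrite /inner -!scalemxAl mxE. Qed.

Lemma innerC (R : realType) (n : nat) (M : smooth_manifold R n)
    (g : riemannian_metric M) (c : chart M) (p : M) (x y : 'rV[R]_n) :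
  chart_dom c p -> inner g c p x y = inner g c p y x.
Proof.
(* A 1x1 matrix has its entry as trace, and the trace is invariant under transposition. The
   hypothesis [hp] places the point in the chart image, where the metric matrix is symmetric. *)
move=> hp; rewrite /inner -[LHS]trace_mx11 -mxtrace_tr !trmx_mul trmxK.
by rewrite Defs.metric_sym ?mulmxA ?trace_mx11 //; exists p.
Qed.

Lemma inner_gt0 (R : realType) (n : nat) (M : smooth_manifold R n)
    (g : riemannian_metric M) (c : chart M) (p : M) (x : 'rV[R]_n) :
  chart_dom c p -> x != 0 -> 0 < inner g c p x x.
Proof. by move=> hp; apply: metric_pos; exists p. Qed.

Lemma inner_normalize (R : realType) (n : nat) (M : smooth_manifold R n)
    (g : riemannian_metric M) (c : chart M) (p : M) (x : 'rV[R]_n) :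
  chart_dom c p -> x != 0 ->
  exists2 a : R, a != 0 & inner g c p (a *: x) (a *: x) = 1.
Proof.
move=> hp x0; have xx := inner_gt0 R n M g c p x hp x0.
exists (Num.sqrt (inner g c p x x))^-1.
  by rewrite invr_eq0 gt_eqF // sqrtr_gt0.
rewrite innerZl innerC // innerZl mulrA -expr2 exprVn sqr_sqrtr ?ltW //.
by rewrite mulVf // gt_eqF.
Qed.

(** Gram-Schmidt on the first two coordinate vectors; [2 <= n] supplies the indices 0 and 1. *)
Lemma orthonormal_pair (R : realType) (n : nat) (M : smooth_manifold R n)
    (g : riemannian_metric M) (c : chart M) (p : M) :
  (2 <= n)%N -> chart_dom c p ->
  exists x y : 'rV[R]_n, [/\ inner g c p x x = 1, inner g c p y y = 1
    & inner g c p x y = 0].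
Proof.
move=> hn hp; pose i0 := Ordinal (ltnW hn); pose i1 := Ordinal hn.
have [||a _ xx] := inner_normalize R n M g c p (delta_mx 0 i0) => //.
  by apply/eqP => /rowP/(_ i0)/eqP; rewrite !mxE !eqxx oner_eq0.
set x := a *: _ in xx.
pose w := delta_mx 0 i1 - inner g c p (delta_mx 0 i1) x *: x.
(* Since [x] is a multiple of the vector at [i0], its coordinate at [i1] vanishes, so that
   coordinate of [w] is 1. *)
have w0 : w != 0.
  apply/eqP => /rowP/(_ i1)/eqP.
  by rewrite !mxE !eqxx /= !mulr0 subr0 oner_eq0.
have [b _ yy] := inner_normalize R n M g c p w hp w0.
exists x, (b *: w); split => //.
by rewrite innerC // innerZl innerBl innerZl xx mulr1 subrr mulr0.
Qed.

Lemma riemann_constant_curvature (R : realType) (n : nat)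
    (M : smooth_manifold R n) (g : riemannian_metric M) (kappa : R)
    (c : chart M) (p : M) (x y z : 'rV[R]_n) :
  constant_curvature g kappa -> chart_dom c p ->
  riemann g c p x y z =
  kappa *: (inner g c p z y *: x - inner g c p z x *: y).
Proof.
move=> hK hp; apply/rowP => i; rewrite !mxE !innerE.
set h := metric g c (chart_map c p).
rewrite !mulr_suml -sumrB mulr_sumr; apply: eq_bigr => j _.
(* With [j] fixed, each summand is regrouped into a factor in [k] times a factor in [l], so that the
   double sums split into products of single sums. *)
transitivity (\sum_k \sum_l
   (kappa * ((i == k)%:R * x 0 k) * (z 0 j * h j l * y 0 l) -
    kappa * (z 0 j * h j k * x 0 k) * ((i == l)%:R * y 0 l))).
  by apply: eq_bigr => k _; apply: eq_bigr => l _; rewrite hK //= -/h; ring.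
(* Contraction with the Kronecker delta extracts the coordinate [i]: of [x] in the first term, of
   [y] in the second. *)
have delta_sum (v : 'rV[R]_n) : \sum_k (i == k)%:R * v 0 k = v 0 i.
  rewrite (bigD1 i) //= eqxx mul1r big1 ?addr0 // => k /negPf ki.
  by rewrite eq_sym ki mul0r.
under eq_bigr => k _ do rewrite sumrB -!mulr_sumr delta_sum.
by rewrite sumrB -!mulr_suml -!mulr_sumr delta_sum; ring.
Qed.

Theorem proposition3 (R : realType) (n : nat) (hn : (2 <= n)%N)
    (M : smooth_manifold R n) (g : riemannian_metric M) (kappa : R)
    (hK : constant_curvature g kappa)
    (p : M) (c : chart M) (hp : chart_dom c p) :
  is_M_eigenvalue g c p kappa /\
  (forall (zeta : R) (x y : 'rV[R]_n),
     M_eigen g c p zeta x y -> ~ (y = x \/ y = - x) -> zeta = kappa).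
Proof.
split.
  have [x [y [xx yy xy]]] := orthonormal_pair R n M g c p hn hp.
  have yx : inner g c p y x = 0 by rewrite innerC.
  exists x, y; split => //; rewrite (riemann_constant_curvature _ _ _ _ kappa) //.
    by rewrite xx xy scale1r scale0r subr0.
  by rewrite yy yx scale1r scale0r subr0.
move=> zeta x y [+ _ xx yy] nxy.
rewrite (riemann_constant_curvature _ _ _ _ kappa) // xx scale1r => E.
apply/eqP/negPn/negP => zk; apply: nxy.
have d0 : kappa - zeta != 0 by rewrite subr_eq0 eq_sym.
(* Solves the first eigenvector equation for [y], dividing by [kappa - zeta], which is nonzero by
   the assumption made for contradiction. *)
have {E} yE : y = ((kappa - zeta)^-1 * (kappa * inner g c p x y)) *: x.
  apply: (scalerI d0); rewrite scalerA mulVKf //.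
  by rewrite scalerBl -E scalerBr scalerA opprB addrC subrK.
move: yE; set t := _^-1 * _ => yE.
(* For y = t x, taking squared norms gives 1 = t^2, as both vectors are unit. *)
have : t ^+ 2 = 1.
  by move: yy; rewrite yE innerZl innerC // innerZl xx mulr1.
move/eqP; rewrite sqrf_eq1 => /orP[] /eqP t1; rewrite yE t1.
  by left; rewrite scale1r.
by right; rewrite scaleN1r.
Qed.
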